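(* Let $\mathcal{R}_r$ be the quasi-Riordan group. For every $[g,f]\in\mathcal{R}_r$, every conjugate $[d,h][g,f][d,h]^{-1}$ with $[d,h]\in\mathcal{R}_r$ belongs to the set $\mathcal{R}(f)_r:=\{[e,f]: e\in\mathcal{F}_0,\ e(0)=1\}$. Consequently, $\mathcal{A}=\{[g,t]: g\in\mathcal{F}_0,\ g(0)=1\}$ is a normal subgroup of $\mathcal{R}_r$.
   Context: $\mathbb{K}$ is $\mathbb{R}$ or $\mathbb{C}$; $\mathcal{F}_r$ denotes the set of formal power series in $\mathbb{K}[[t]]$ of order $r$. For $g\in\mathcal{F}_0$ with $g(0)=1$ and $f\in\mathcal{F}_1$, the quasi-Riordan array $[g,f]$ is the infinite lower triangular matrix whose $0$th column has generating function $g$ and whose $j$th column, for $j\ge1$, has generating function $t^{j-1}f$. $\mathcal{R}_r$ is the set of all quasi-Riordan arrays, a group under matrix multiplication. *)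

(* Defs.v *)
From HB Require Import structures.
From mathcomp Require Import all_boot all_order all_algebra.
From mathcomp Require Import boolp classical_sets reals.
From mathcomp Require Import complex.

Set Implicit Arguments.
Unset Strict Implicit.
Unset Printing Implicit Defensive.

Import GRing.Theory.

Local Open Scope classical_set_scope.
Local Open Scope ring_scope.

Variant scalar_kind := RealScalars | ComplexScalars.

Definition scalars (R : realType) (k : scalar_kind) : fieldType :=
  match k with
  | RealScalars => R
  | ComplexScalars => complex R
  end.

(* The formal power series \sum_n (f n) t^n of K[[t]]. *)
Definition fps (K : fieldType) : Type := nat -> K.

Section Fps.
Variable K : fieldType.
Implicit Types f g : fps K.

Definition fps_mul f g : fps K := fun n => \sum_(i < n.+1) f i * g (n - i)%N.

Definition fps_X (k : nat) : fps K := fun n => (n == k)%:R.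

Definition fps_order (r : nat) : set (fps K) :=
  [set f | (forall i, (i < r)%N -> f i = 0) /\ f r != 0].

Definition fps_unital : set (fps K) := [set g | fps_order 0 g /\ g 0%N = 1].

Lemma fps_X1_order : fps_order 1 (fps_X 1).
Proof.
split=> [i|]; last by rewrite /fps_X eqxx oner_neq0.
by rewrite ltnS leqn0 => /eqP ->.
Qed.

Lemma fps_mulXn k f n :
  fps_mul (fps_X k) f n = if (k <= n)%N then f (n - k)%N else 0.
Proof.
rewrite /fps_mul /fps_X; case: leqP => kn.
  have kn1 : (k < n.+1)%N by [].
  rewrite (bigD1 (Ordinal kn1)) //= eqxx mul1r big1 ?addr0 // => i /eqP ik.
  case: eqP => [ik'|_]; last by rewrite mul0r.
  by case: ik; apply: val_inj.
rewrite big1 // => i _; case: eqP => [ik|_]; last by rewrite mul0r.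
by have := ltn_ord i; rewrite ik ltnS leqNgt kn.
Qed.

Lemma fps_mulC f g : fps_mul f g = fps_mul g f.
Proof.
apply: funext => n; rewrite /fps_mul (reindex_inj rev_ord_inj) /=.
apply: eq_bigr => i _; rewrite subSS mulrC; congr (g _ * _).
by rewrite subKn // -ltnS.
Qed.

Section Inverse.
Variable f : fps K.
Hypothesis f0 : f 0%N != 0.

Let invs := fix invs (n : nat) : seq K :=
  if n is m.+1 then
    rcons (invs m)
      ((f 0%N)^-1 * ((m == 0%N)%:R - \sum_(i < m) f (m - i)%N * (invs m)`_i))
  else [::].

Let size_invs n : size (invs n) = n.
Proof. by elim: n => //= n IHn; rewrite size_rcons IHn. Qed.

Let nth_invs n i : (i < n)%N -> (invs n)`_i = (invs i.+1)`_i.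
Proof.
elim: n => // n IHn; rewrite ltnS leq_eqVlt => /orP[/eqP -> //|lt_in].
by rewrite -IHn //= nth_rcons size_invs lt_in.
Qed.

Lemma fps_inv_exists : exists g, g 0%N != 0 /\ fps_mul g f = fps_X 0.
Proof.
pose g n := (invs n.+1)`_n.
have gE n : g n = (f 0%N)^-1 *
    ((n == 0%N)%:R - \sum_(i < n) f (n - i)%N * g i).
  rewrite {1}/g /= nth_rcons size_invs ltnn eqxx; congr (_ * (_ - _)).
  by apply: eq_bigr => i _; rewrite nth_invs.
exists g; split; first by rewrite gE big_ord0 subr0 mulr1 invr_eq0.
apply: funext => n; rewrite /fps_mul /fps_X big_ord_recr /= subnn gE.
rewrite mulrAC mulVf // mul1r addrC.
by under [X in _ + X]eq_bigr => i _ do rewrite mulrC; rewrite subrK.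
Qed.

End Inverse.
End Fps.

Arguments fps_X K k : clear implicits.
Arguments fps_X1_order K : clear implicits.
Arguments fps_order {K} r _.
Arguments fps_unital {K} _.

Section QuasiRiordan.
Variable K : fieldType.
Implicit Types f g d h : fps K.

(* Infinite matrices; A n j is the entry in row n and column j. *)
Definition imx : Type := nat -> nat -> K.
Implicit Types A B C : imx.

Definition lower_triangular A := forall n j, (n < j)%N -> A n j = 0.

(* The product of lower triangular matrices: row n of A vanishes past
   column n, so the sum over all j stops there. *)
Definition imx_mul A B : imx :=
  fun n k => \sum_(j < n.+1) A n j * B j k.

Definition imx_one : imx := fun n k => (n == k)%:R.

(* The array [g, f]: column 0 is g and column i.+1 is t^i f. *)
Definition qrmx g f : imx := fun n j =>
  if j is i.+1 then fps_mul (fps_X K i) f n else g n.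

Lemma qrmx_lower_triangular g f :
  fps_order 1 f -> lower_triangular (qrmx g f).
Proof.
move=> [f0 _] n [//|j]; rewrite ltnS => le_nj; rewrite /qrmx fps_mulXn.
case: leqP => // le_jn; have -> : n = j by apply/eqP; rewrite eqn_leq le_nj.
by rewrite subnn f0.
Qed.

Record quasi_riordan := QuasiRiordan {
  qr_mx :> imx;
  qr_mxP : exists g f, [/\ fps_unital g, fps_order 1 f & qr_mx = qrmx g f]
}.

Lemma qr_mx_inj : injective qr_mx.
Proof.
move=> [A pA] [B pB] /= AB; rewrite AB in pA *.
by congr QuasiRiordan; apply: Prop_irrelevance.
Qed.

Fact qr_subproof g f (gP : fps_unital g) (fP : fps_order 1 f) :
  exists g' f', [/\ fps_unital g', fps_order 1 f' & qrmx g f = qrmx g' f'].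
Proof. by exists g, f. Qed.

Definition qr g f (gP : fps_unital g) (fP : fps_order 1 f) :
  quasi_riordan := QuasiRiordan (qr_subproof gP fP).

Lemma imx_oneE : imx_one = qrmx (fps_X K 0) (fps_X K 1).
Proof.
apply: funext => n; apply: funext => -[//|j].
rewrite /qrmx fps_mulXn /fps_X /imx_one; case: leqP => [le_jn|lt_nj].
  by rewrite -[(n - j == 1)%N](eqn_add2l j) subnKC // addn1.
by case: eqP => // nj; rewrite nj ltnNge leqnSn in lt_nj.
Qed.

Fact imx_one_subproof :
  exists g f, [/\ fps_unital g, fps_order 1 f & imx_one = qrmx g f].
Proof.
exists (fps_X K 0), (fps_X K 1); split.
- by do !split=> //; rewrite /fps_X eqxx ?oner_neq0.
- exact: fps_X1_order.
- exact: imx_oneE.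
Qed.

Lemma qrmx_mul g f d h : fps_order 1 h ->
  imx_mul (qrmx g f) (qrmx d h) =
  qrmx (fun n => if n is m.+1
                 then g m.+1 * d 0%N + fps_mul (f \o succn) (d \o succn) m
                 else g 0%N * d 0%N)
       (fun n => if n is m.+1
                 then fps_mul (f \o succn) (h \o succn) m else 0).
Proof.
move=> [h0 _]; apply: funext => n; apply: funext => k.
rewrite /imx_mul big_ord_recl /=.
have fE (i : 'I_n) : fps_mul (fps_X K i) f n = f (n - i)%N.
  by rewrite fps_mulXn ltnW.
under eq_bigr => i _ do rewrite /bump /= add1n /= fE.
case: k => [|k] /=.
  case: n fE => [|n] _; first by rewrite big_ord0 addr0.
  rewrite fps_mulC; congr (_ + _); apply: eq_bigr => i _ /=.
  by rewrite mulrC subSn // -ltnS.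
rewrite fps_mulXn.
have -> : (if (k <= 0)%N then h (0 - k)%N else 0) = 0.
  by rewrite sub0n h0 ?if_same.
rewrite mulr0 add0r fps_mulXn.
under eq_bigr => i _ do rewrite fps_mulXn.
case: leqP => [le_kn|lt_nk]; last first.
  rewrite big1 // => i _.
  by rewrite leqNgt (leq_ltn_trans _ lt_nk) //= mulr0.
rewrite -(subnK le_kn); move: (n - k)%N => m {n fE le_kn}.
rewrite addnK addnC big_split_ord /= big1 ?add0r => [|i _]; last first.
  case: leqP => [le_ki|]; last by rewrite mulr0.
  have /eqP -> : (i.+1 - k == 0)%N by rewrite subn_eq0 ltn_ord.
  by rewrite h0 ?mulr0.
case: m => [|m]; first by rewrite big_ord0.
rewrite fps_mulC; apply: eq_bigr => i _ /=.
rewrite -addnS leq_addr addKn subnDl mulrC.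
by rewrite subSn // -ltnS.
Qed.

Fact imx_mul_subproof (x y : quasi_riordan) :
  exists g f, [/\ fps_unital g, fps_order 1 f & imx_mul x y = qrmx g f].
Proof.
have [g [f [[_ g0] [f0 f1] ->]]] := qr_mxP x.
have [d [h [[_ d0] hP ->]]] := qr_mxP y.
rewrite qrmx_mul //; eexists; eexists; split; last reflexivity.
  by do !split=> //=; rewrite g0 d0 mulr1 ?oner_neq0.
case: hP => _ h1; split=> [[]//|] /=.
by rewrite /fps_mul big_ord1 /= mulf_neq0.
Qed.

Definition qr_mul (x y : quasi_riordan) : quasi_riordan :=
  QuasiRiordan (imx_mul_subproof x y).

Definition qr_one : quasi_riordan := QuasiRiordan imx_one_subproof.

Lemma qr_lower_triangular (x : quasi_riordan) : lower_triangular x.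
Proof.
by have [g [f [_ fP ->]]] := qr_mxP x; apply: qrmx_lower_triangular.
Qed.

Lemma imx_mulA A B C :
  lower_triangular B -> imx_mul A (imx_mul B C) = imx_mul (imx_mul A B) C.
Proof.
move=> ltB; apply: funext => n; apply: funext => k; rewrite /imx_mul.
under [RHS]eq_bigr => j _ do rewrite mulr_suml.
rewrite exchange_big /=; apply: eq_bigr => i _; rewrite mulr_sumr.
under [RHS]eq_bigr => j _ do rewrite -mulrA.
rewrite (big_ord_widen n.+1 (fun j => A n i * (B i j * C j k))) //=.
rewrite big_mkcond /=; apply: eq_bigr => j _.
by rewrite ltnS; case: leqP => // lt_ij; rewrite ltB // mul0r mulr0.
Qed.

Fact qr_mulA : associative qr_mul.
Proof.
by move=> x y z; apply/qr_mx_inj/imx_mulA; apply: qr_lower_triangular.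
Qed.

Fact qr_mul1 : left_id qr_one qr_mul.
Proof.
move=> x; apply: qr_mx_inj; apply: funext => n; apply: funext => k /=.
rewrite /imx_mul big_ord_recr /= /imx_one eqxx mul1r big1 ?add0r // => i _.
by rewrite gtn_eqF // mul0r.
Qed.

Fact qr_mulr1 : right_id qr_one qr_mul.
Proof.
move=> x; apply: qr_mx_inj; apply: funext => n; apply: funext => k /=.
rewrite /imx_mul /imx_one; case: (leqP k n) => [le_kn|lt_nk].
  have lt_kn1 : (k < n.+1)%N by [].
  rewrite (bigD1 (Ordinal lt_kn1)) //= eqxx mulr1 big1 ?addr0 // => i /eqP ik.
  case: eqP => [ik'|_]; last by rewrite mulr0.
  by case: ik; apply: val_inj.
rewrite qr_lower_triangular // big1 // => i _.
by rewrite ltn_eqF ?mulr0 // (leq_ltn_trans _ lt_nk) // -ltnS.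
Qed.

Fact qr_inv_exists (x : quasi_riordan) : exists y, qr_mul y x = qr_one.
Proof.
have [g [f [[_ g0] fP xE]]] := qr_mxP x.
have [u [u0 ufE]] := @fps_inv_exists K (f \o succn) fP.2.
pose h : fps K := fun n => if n is m.+1 then u m else 0.
pose d : fps K := fun n =>
  if n is m.+1 then - fps_mul u (g \o succn) m else 1.
have hP : fps_order 1 h by split=> [[]|].
have dP : fps_unital d by do !split=> //; rewrite /= oner_neq0.
exists (qr dP hP); apply: qr_mx_inj => /=.
rewrite xE qrmx_mul // imx_oneE.
congr qrmx; apply: funext => -[|n] /=.
- by rewrite g0 mulr1.
- by rewrite g0 mulr1 addNr.
- by [].
- by rewrite [LHS](congr1 (fun s : fps K => s n) ufE).
Qed.

Definition qr_inv (x : quasi_riordan) : quasi_riordan :=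
  sval (cid (qr_inv_exists x)).

Fact qr_mulVg : left_inverse qr_one qr_inv qr_mul.
Proof. by move=> x; rewrite /qr_inv; case: cid. Qed.

Fact qr_mulgV : right_inverse qr_one qr_inv qr_mul.
Proof.
move=> x; rewrite -[LHS]qr_mul1 -{1}(qr_mulVg (qr_inv x)) -qr_mulA.
by rewrite (qr_mulA (qr_inv x) x) qr_mulVg qr_mul1 qr_mulVg.
Qed.

HB.instance Definition _ := gen_eqMixin quasi_riordan.
HB.instance Definition _ := gen_choiceMixin quasi_riordan.
HB.instance Definition _ := isGroup.Build quasi_riordan
  qr_mulA qr_mul1 qr_mulr1 qr_mulVg qr_mulgV.

(* The arrays [e, f] whose second entry is the given f. *)
Definition qr_second f (fP : fps_order 1 f) : set quasi_riordan :=
  [set x | exists e (eP : fps_unital e), x = qr eP fP].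

Definition qr_appell : set quasi_riordan :=
  [set x | exists g (gP : fps_unital g), x = qr gP (fps_X1_order K)].

End QuasiRiordan.

Arguments qr_second {K f} fP _.
Arguments qr_appell K _ : clear implicits.

Definition normal_subgroup (G : groupType) (H : set G) : Prop :=
  group_closed (mem H) /\ forall x y : G, H x -> H (x ^ y)%g.

(* Main.v *)
(* Column 1 of [g, f] is f, and column 1 of a product of arrays is t times the
   Cauchy product of the two second entries divided by t.  So f is a
   commutative homomorphic invariant of [g, f], hence unchanged by conjugation,
   and the arrays [g, t] form the kernel of this homomorphism. *)
Require Import Defs.
From mathcomp Require Import all_boot all_order all_algebra.
From mathcomp Require Import boolp classical_sets reals.

Set Implicit Arguments.
Unset Strict Implicit.
Unset Printing Implicit Defensive.

Local Open Scope group_scope.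

Definition second (K : fieldType) (x : quasi_riordan K) : fps K :=
  fun n => qr_mx x n 1%N.

Lemma qrmx_col1 (K : fieldType) (g f : fps K) n : qrmx g f n 1%N = f n.
Proof. by rewrite /qrmx fps_mulXn subn0. Qed.

(** Turns the existential in [qr_second] into an equation on column 1, since column 0 may be any
    unital series. *)
Lemma qr_secondP (K : fieldType) (f : fps K) (fP : fps_order 1 f) x :
  qr_second fP x <-> second x = f.
Proof.
split=> [[e [eP ->]]|xf]; first by apply: funext => n; apply: qrmx_col1.
have [g [f' [gP _ xE]]] := qr_mxP x.
(* Comparing matrices only avoids matching the order proofs of [f'] and [f]. *)
exists g, gP; apply: qr_mx_inj; rewrite xE /=; congr qrmx.
by rewrite -xf; apply: funext => n; rewrite /second xE qrmx_col1.
Qed.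

Lemma second_mul (K : fieldType) (x y : quasi_riordan K) :
  second (x * y) = fun n =>
    if n is m.+1
    then fps_mul (fun i => second x i.+1) (fun i => second y i.+1) m else 0%R.
Proof.
have [g [f [_ _ xE]]] := qr_mxP x; have [d [h [_ hP yE]]] := qr_mxP y.
apply: funext => n; rewrite {1}/second /= xE yE qrmx_mul // qrmx_col1.
case: n => // n; apply: eq_bigr => i _ /=.
by rewrite /second xE yE !qrmx_col1.
Qed.

Lemma second_mulC (K : fieldType) (x y : quasi_riordan K) :
  second (x * y) = second (y * x).
Proof. by rewrite !second_mul; apply: funext => -[//|n]; rewrite fps_mulC. Qed.

(** By [second_mul], the left factor enters only through its second entry. *)
Lemma second_mull (K : fieldType) (x x' y : quasi_riordan K) :
  second x = second x' -> second (x * y) = second (x' * y).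
Proof. by rewrite !second_mul => ->. Qed.

(** Under [second], [x * y] may be replaced by [y * x], and then [x] cancels. *)
Lemma second_conj (K : fieldType) (x y : quasi_riordan K) :
  second (x * y * x^-1) = second y.
Proof. by rewrite (second_mull _ (second_mulC x y)) mulgK. Qed.

Lemma second1 (K : fieldType) : second (1 : quasi_riordan K) = fps_X K 1.
Proof.
by apply: funext => n; rewrite /second [qr_mx _]imx_oneE qrmx_col1.
Qed.

(** Written with [1] in place of [t], membership becomes a kernel condition. *)
Lemma qr_appellP (K : fieldType) (x : quasi_riordan K) :
  qr_appell K x <-> second x = second (1 : quasi_riordan K).
Proof. by rewrite second1; apply: (qr_secondP (fps_X1_order K)). Qed.

Theorem theorem3p4 (R : realType) (k : scalar_kind) :
  (forall (g f d h : fps (scalars R k))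
     (gP : fps_unital g) (fP : fps_order 1 f)
     (dP : fps_unital d) (hP : fps_order 1 h),
     qr_second fP (qr dP hP * qr gP fP * (qr dP hP)^-1)%g) /\
  normal_subgroup (qr_appell (scalars R k)).
Proof.
split=> [g f d h gP fP dP hP|].
  by apply/qr_secondP; rewrite second_conj; apply/(qr_secondP fP); exists g, gP.
split=> [|x y /qr_appellP xA]; last first.
  (* Commuting moves [y^-1] to the right end, next to [y]. *)
  apply/qr_appellP; rewrite -xA conjgE second_mulC.
  by rewrite -mulgA mulgV mulg1.
split=> [|x y]; first by apply/mem_set/qr_appellP.
move=> /set_mem/qr_appellP xA /set_mem/qr_appellP yA.
apply/mem_set/qr_appellP.
(* In the quotient of [x] by [y], the factor [x] is traded for [1], then [1] for [y]. *)
by rewrite (second_mull _ xA) -(second_mull _ yA) mulgV.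
Qed.
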